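(* Let $n\ge 2$, let $A\in\widetilde{\mathcal H}_n$ be synchronizing at level $k$, and let $r\ge k$. If the graph of bad pairs $G_r(A)$ has a circuit (a directed closed path of length at least one), then the automaton group generated by $A$, i.e. the group of homeomorphisms of $X_n^{\mathbb N}$ generated by $\{A_q: q \text{ a state of } A\}$, is infinite.
   Context: $X_n=\{0,\dots,n-1\}$. A synchronous transducer $A=\langle X_n,Q,\pi,\lambda\rangle$ has finite state set $Q$, transition function $\pi:X_n\times Q\to Q$ and output function $\lambda:X_n\times Q\to X_n$, extended to words by $\pi(\Gamma x,q)=\pi(x,\pi(\Gamma,q))$, $\lambda(\Gamma x,q)=\lambda(\Gamma,q)\lambda(x,\pi(\Gamma,q))$. Each state $q$ induces a continuous map $A_q:X_n^{\mathbb N}\to X_n^{\mathbb N}$; $q$ is a homeomorphism state if $A_q$ is a homeomorphism. Two states are $\omega$-equivalent if they induce the same map; $A$ is minimal if distinct states are never $\omega$-equivalent. Product: $A*B$ has states $Q_A\times Q_B$, $\pi_{A*B}(x,(p,q))=(\pi_A(x,p),\pi_B(\lambda_A(x,p),q))$, $\lambda_{A*B}(x,(p,q))=\lambda_B(\lambda_A(x,p),q)$. $A^i=A*\cdots*A$ ($i$ factors) has states $Q^i$ and transition/output functions $\pi_i,\lambda_i$. $A$ is synchronizing at level $k$ if there is $\mathfrak s:X_n^k\to Q$ with $\pi(\Gamma,q)=\mathfrak s(\Gamma)$ for all $\Gamma\in X_n^k$, $q\in Q$; $\mathfrak s(\Gamma)$ is the state forced by $\Gamma$; more generally, a word of length at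 least $k$ forces the unique state to which it is read from every state. The core of $A$ is the image of $\mathfrak s$, and $A$ is core if it equals its core. $\widetilde{\mathcal P}_n$ is the monoid of finite, synchronous, synchronizing, core transducers, each represented by its minimal transducer. $\widetilde{\mathcal H}_n$ is the set of elements of $\widetilde{\mathcal P}_n$ having a homeomorphism state (then all states are homeomorphism states). Splits. Let $A\in\widetilde{\mathcal P}_n$ and let $r$ be at least the minimal synchronizing level of $A$. For a state $t$ let $W_t$ be the set of words, of length at least the minimal synchronizing level, forcing $t$. A split of length $l\ge 1$ (of the level-$r$ dual $A^\vee_r$) is a triple $((q_1,\dots,q_l),(p_1,\dots,p_l),\Gamma)$ with $q_i,p_i\in Q$, $\Gamma\in X_n^r$, such that there are $s_1,\dots,s_l\in Q$ and distinct $t_1,t_2\in Q$ satisfying: with $\Gamma_0=\Lambda_0=\Gamma$, $\Gamma_i=\lambda(\Gamma_{i-1},p_i)$, $\Lambda_i=\lambda(\Lambda_{i-1},q_i)$ for $1\le i\le l$, one has $\Gamma_i,\Lambda_i\in W_{s_{i+1}}$ for $0\le i\le l-1$, $\Gamma_l\in W_{t_1}$, $\Lambda_l\in W_{t_2}$. Its top is $\{p_1,q_1\}$ and its bottom is $\{t_1,t_2\}$. The bottom of the split depends only on the top if for all $U_1,U_2\in Q^{l-1}$ the triple $((q_1,U_1),(p_1,U_2),\Gamma)$ is also a split with bottom $\{t_1,t_2\}$, and moreover for all $u,u'\in Q$, $\pi_{l+1}(\Gamma,(p_1,\dots,p_l,u))=\pi_{l+1}(\Gamma,(p_1,U_2,u'))$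 and $\pi_{l+1}(\Gamma,(q_1,\dots,q_l,u))=\pi_{l+1}(\Gamma,(q_1,U_1,u'))$. Graph of bad pairs. $G_r(A)$ is the directed graph whose vertices (the bad pairs) are the tops of those splits of $A^\vee_r$ (of any length) whose bottom depends only on the top; there is an edge from the bad pair $\{x_1,x_2\}$ to the bad pair $\{y_1,y_2\}$ if there is a split of $A^\vee_r$ with top $\{x_1,x_2\}$ and bottom $\{y_1,y_2\}$ whose bottom depends only on the top. *)

(* Defs.v *)
From HB Require Import structures.
From mathcomp Require Import all_boot all_order.
From mathcomp Require Import all_classical.
From mathcomp Require Import topology.

Set Implicit Arguments.
Unset Strict Implicit.
Unset Printing Implicit Defensive.

Record transducer (n : nat) := Transducer {
  state : finType;
  tpi : 'I_n -> state -> state;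
  tlam : 'I_n -> state -> 'I_n }.

Fixpoint piw n (A : transducer n) (w : seq 'I_n) (q : state A) : state A :=
  if w is x :: w' then piw w' (tpi x q) else q.

Fixpoint lamw n (A : transducer n) (w : seq 'I_n) (q : state A) : seq 'I_n :=
  if w is x :: w' then tlam x q :: lamw w' (tpi x q) else [::].

Lemma piw_rcons n (A : transducer n) w x (q : state A) :
  piw (rcons w x) q = tpi x (piw w q).
Proof. by elim: w q => //=. Qed.

Lemma lamw_rcons n (A : transducer n) w x (q : state A) :
  lamw (rcons w x) q = rcons (lamw w q) (tlam x (piw w q)).
Proof. by elim: w q => //= y w IH q; rewrite IH. Qed.

Definition cantor (n : nat) :=
  prod_topology (fun _ : nat => discrete_topology 'I_n).

Definition act n (A : transducer n) (q : state A) (x : cantor n) : cantor n :=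
  fun i => tlam (x i) (piw (mkseq x i) q).

Definition homeomorphism n (f : cantor n -> cantor n) : Prop :=
  continuous f /\
  exists g : cantor n -> cantor n, [/\ cancel f g, cancel g f & continuous g].

Definition omega_equiv n (A : transducer n) (p q : state A) : Prop :=
  act p =1 act q.

Definition minimal n (A : transducer n) : Prop :=
  forall p q : state A, omega_equiv p q -> p = q.

Definition tprod n (A B : transducer n) : transducer n :=
  @Transducer n (state A * state B)%type
    (fun x pq => (tpi x pq.1, tpi (tlam x pq.1) pq.2))
    (fun x pq => tlam (tlam x pq.1) pq.2).

(* [tpowS A l] is A^(l+1), with l+1 factors. *)
Fixpoint tpowS n (A : transducer n) (l : nat) : transducer n :=
  if l is l'.+1 then tprod A (tpowS A l') else A.

Fixpoint tpowS_state n (A : transducer n) (l : nat) :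
    l.+1.-tuple (state A) -> state (tpowS A l) :=
  match l return l.+1.-tuple (state A) -> state (tpowS A l) with
  | 0 => fun t => thead t
  | l'.+1 => fun t => (thead t, tpowS_state (behead_tuple t))
  end.

Definition sync_map n (A : transducer n) (k : nat)
    (s : k.-tuple 'I_n -> state A) : Prop :=
  forall (G : k.-tuple 'I_n) (q : state A), piw G q = s G.

Definition synchronizing_at n (A : transducer n) (k : nat) : Prop :=
  exists s : k.-tuple 'I_n -> state A, sync_map s.

Definition min_sync_level n (A : transducer n) (m : nat) : Prop :=
  synchronizing_at A m /\ forall j, synchronizing_at A j -> m <= j.

(* The image of the synchronizing map does not depend on the level. *)
Definition is_core n (A : transducer n) : Prop :=
  exists (k : nat) (s : k.-tuple 'I_n -> state A),
    sync_map s /\ forall t : state A, exists G, s G = t.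

Definition in_Pn n (A : transducer n) : Prop :=
  [/\ exists k, synchronizing_at A k, is_core A & minimal A].

Definition in_Hn n (A : transducer n) : Prop :=
  in_Pn A /\ exists q : state A, homeomorphism (act q).

Inductive automaton_group n (A : transducer n) : set (cantor n -> cantor n) :=
  | autgrp_gen (q : state A) : automaton_group A (act q)
  | autgrp_id : automaton_group A id
  | autgrp_comp f g : automaton_group A f -> automaton_group A g ->
      automaton_group A (f \o g)
  | autgrp_inv f g : automaton_group A f -> cancel f g -> cancel g f ->
      automaton_group A g.

Definition forcing_words n (A : transducer n) (t : state A)
    (w : seq 'I_n) : Prop :=
  (exists2 m, min_sync_level A m & m <= size w) /\
  forall q : state A, piw w q = t.

(* [lam_iter G p i] is Gamma_i: the word G acted on by p_1, ..., p_i. *)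
Definition lam_iter n (A : transducer n) (G : seq 'I_n)
    (p : seq (state A)) (i : nat) : seq 'I_n :=
  foldl (@lamw n A) G (take i p).

(* Splits have positive length l = m.+1; [tnth s i] is s_(i+1). *)
Definition split_at n (A : transducer n) (r m : nat)
    (q p : m.+1.-tuple (state A)) (G : r.-tuple 'I_n)
    (t1 t2 : state A) : Prop :=
  t1 != t2 /\
  exists s : m.+1.-tuple (state A),
    [/\ forall i : 'I_m.+1,
          forcing_words (tnth s i) (lam_iter G p i) /\
          forcing_words (tnth s i) (lam_iter G q i),
        forcing_words t1 (lam_iter G p m.+1) &
        forcing_words t2 (lam_iter G q m.+1)].

Definition split_with_bottom n (A : transducer n) (r m : nat)
    (q p : m.+1.-tuple (state A)) (G : r.-tuple 'I_n)
    (B : {set state A}) : Prop :=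
  exists t1 t2 : state A, split_at q p G t1 t2 /\ B = [set t1; t2].

Definition split_top n (A : transducer n) (m : nat)
    (q p : m.+1.-tuple (state A)) : {set state A} :=
  [set thead p; thead q].

Definition bottom_depends_on_top n (A : transducer n) (r m : nat)
    (q p : m.+1.-tuple (state A)) (G : r.-tuple 'I_n)
    (B : {set state A}) : Prop :=
  forall U1 U2 : m.-tuple (state A),
    let q' := [tuple of thead q :: U1] in
    let p' := [tuple of thead p :: U2] in
    split_with_bottom q' p' G B /\
    forall u u' : state A,
      piw G (tpowS_state [tuple of rcons p u]) =
        piw G (tpowS_state [tuple of rcons p' u']) /\
      piw G (tpowS_state [tuple of rcons q u]) =
        piw G (tpowS_state [tuple of rcons q' u']).

Definition good_split n (A : transducer n) (r : nat)
    (T B : {set state A}) : Prop :=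
  exists (m : nat) (q p : m.+1.-tuple (state A)) (G : r.-tuple 'I_n),
    [/\ split_with_bottom q p G B, bottom_depends_on_top q p G B &
        T = split_top q p].

Definition bad_pair n (A : transducer n) (r : nat)
    (V : {set state A}) : Prop :=
  exists B : {set state A}, good_split r V B.

Definition bad_edge n (A : transducer n) (r : nat)
    (V V' : {set state A}) : Prop :=
  [/\ bad_pair r V, bad_pair r V' & good_split r V V'].

Definition has_circuit (T : eqType) (e : T -> T -> Prop) : Prop :=
  exists2 c : seq T, c != [::] & cycle (fun x y => `[< e x y >]) c.

(* Main.v *)
Require Import Defs.
From mathcomp Require Import all_boot all_order.
From mathcomp Require Import all_classical.

(** If the automaton group is finite, then the minimal transducers of the powers
    of [A] have a common synchronizing level: two states of a power of [A] that
    act differently after a long common word would, by pigeonhole, act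
    differently along a loop, which contradicts synchronization of that power.
    A circuit of bad pairs contradicts this. Composing its edges, one after the
    other and in ever deeper coordinates, gives arbitrarily long words that lead
    two states of a power of [A] to [(S, t1)] and [(S, t2)] with [t1 != t2], and
    these act differently, as [S] acts surjectively and [A] is minimal. *)

Set Implicit Arguments.
Unset Strict Implicit.
Unset Printing Implicit Defensive.

(** * Powers of [A] acting on finite and infinite words *)

Section Powers.
Variables (n : nat) (A : transducer n).
Implicit Types (q : state A) (P S U : seq (state A)) (w v : seq 'I_n).
Implicit Types (x : 'I_n) (z : cantor n).

(* States of the powers of [A] are represented as sequences, so that powers
   with different numbers of factors can be concatenated. *)
Fixpoint ppi x P : seq (state A) :=
  if P is q :: P' then tpi x q :: ppi (tlam x q) P' else [::].

Fixpoint ppiw w P : seq (state A) :=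
  if w is x :: w' then ppiw w' (ppi x P) else P.

Definition pact P z : cantor n := foldl (fun z q => act q z) z P.

Lemma size_ppi x P : size (ppi x P) = size P.
Proof. by elim: P x => //= q P IH x; rewrite IH. Qed.

Lemma size_ppiw w P : size (ppiw w P) = size P.
Proof. by elim: w P => //= x w IH P; rewrite IH size_ppi. Qed.

Lemma size_lamw w q : size (lamw w q) = size w.
Proof. by elim: w q => //= x w IH q; rewrite IH. Qed.

Lemma ppiw_nil w : ppiw w [::] = [::].
Proof. by elim: w. Qed.

Lemma ppiw_cons w q P : ppiw w (q :: P) = piw w q :: ppiw (lamw w q) P.
Proof. by elim: w q P => //= x w IH q P; rewrite IH. Qed.

Lemma ppiw_catw w v P : ppiw (w ++ v) P = ppiw v (ppiw w P).
Proof. by elim: w P => //=. Qed.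

Lemma ppiw_cat w P U :
  ppiw w (P ++ U) = ppiw w P ++ ppiw (foldl (@lamw n A) w P) U.
Proof.
elim: P w => [|q P IH] w /=; first by rewrite ppiw_nil.
by rewrite !ppiw_cons IH.
Qed.

Fixpoint seq_of_tpowS m : state (tpowS A m) -> seq (state A) :=
  match m return state (tpowS A m) -> seq (state A) with
  | 0 => fun p => [:: p]
  | m'.+1 => fun p => p.1 :: seq_of_tpowS p.2
  end.

Lemma seq_of_tpowS_state m (t : m.+1.-tuple (state A)) :
  seq_of_tpowS (tpowS_state t) = t.
Proof.
elim: m t => [|m IH] t /=; last by rewrite IH [in RHS](tuple_eta t).
by case/tupleP: t => q t; rewrite theadE (tuple0 t).
Qed.

Lemma seq_of_tpowS_pi m x (q : state (tpowS A m)) :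
  seq_of_tpowS (tpi x q) = ppi x (seq_of_tpowS q).
Proof. by elim: m x q => //= m IH x q; rewrite IH. Qed.

Lemma seq_of_tpowS_piw m w (q : state (tpowS A m)) :
  seq_of_tpowS (piw w q) = ppiw w (seq_of_tpowS q).
Proof. by elim: w q => //= x w IH q; rewrite IH seq_of_tpowS_pi. Qed.

Definition scons x z : cantor n := fun i => if i is j.+1 then z j else x.

Lemma act_scons q x z : act q (scons x z) = scons (tlam x q) (act (tpi x q) z).
Proof.
apply: funext => -[|i] //; rewrite /act /mkseq /= (iotaDl 1 0) -map_comp.
by congr (tlam _ (piw _ _)); apply: eq_map.
Qed.

Lemma scons_eta z : z = scons (z 0) (fun i => z i.+1).
Proof. by apply: funext => -[]. Qed.

Lemma scons_inj x y z z' : scons x z = scons y z' -> x = y /\ z = z'.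
Proof.
move=> e; split; first exact: (congr1 (fun f : cantor n => f 0) e).
by apply: funext => i; exact: (congr1 (fun f : cantor n => f i.+1) e).
Qed.

Lemma pact_scons P x z :
  pact P (scons x z) = scons (foldl (@tlam n A) x P) (pact (ppi x P) z).
Proof.
by elim: P x z => //= q P IH x z; rewrite /pact /= act_scons; apply: IH.
Qed.

(** Prepending a letter to the input and stripping the first output letter recovers the map after
    that letter. Transitions are thus well defined modulo equality of maps. *)
Lemma pact_ppiw w P P' : pact P = pact P' -> pact (ppiw w P) = pact (ppiw w P').
Proof.
elim: w P P' => //= x w IH P P' e; apply: IH; apply: funext => z.
have := congr1 (fun f => f (scons x z)) e.
by rewrite /= !pact_scons => /scons_inj[].
Qed.

Lemma automaton_group_pact P : automaton_group A (pact P).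
Proof.
elim: P => [|q P IH]; first exact: autgrp_id.
exact: (autgrp_comp IH (autgrp_gen q)).
Qed.

(** * Surjectivity of the states *)

Definition asurj q := forall z, exists y, act q y = z.

Lemma asurj_tlam_onto q : asurj q -> forall x, exists y, tlam y q = x.
Proof.
move=> sq x; have [y /(congr1 (fun f : cantor n => f 0)) e] := sq (fun=> x).
by exists (y 0); rewrite -[RHS]e.
Qed.

(** The letter map of [q] is onto, hence injective since the alphabet is finite. So a preimage of a
    sequence starting with [tlam x q] must start with [x]. *)
Lemma asurj_tpi q x : asurj q -> asurj (tpi x q).
Proof.
move=> sq z; have [y] := sq (scons (tlam x q) z).
rewrite [y]scons_eta act_scons => /scons_inj[e <-].
have /(_ _ _ e) <- : injective (fun y : 'I_n => tlam y q); last by eexists.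
have sq' := asurj_tlam_onto sq.
have [g gK] := fin_all_exists sq'.
have gi : injective g by move=> a b eg; rewrite -[a]gK eg gK.
have [h _ hg] := injF_bij gi.
by move=> a b; rewrite -[a]hg -[b]hg !gK => ->.
Qed.

Lemma asurj_piw q w : asurj q -> asurj (piw w q).
Proof. by elim: w q => //= x w IH q sq; apply/IH/asurj_tpi. Qed.

(** As [A] is core, every state is reached from the homeomorphism state. *)
Lemma in_Hn_asurj : in_Hn A -> forall q, asurj q.
Proof.
move=> [[_ [k [s [sP cP]]] _] [q0 [_ [g [_ gK _]]]]] q.
have [G <-] := cP q; rewrite -(sP G q0); apply: asurj_piw => z.
by exists (g z).
Qed.

Lemma lamw_onto q : (forall q, asurj q) -> forall w, exists v, lamw v q = w.
Proof.
move=> sA w; elim: w q => [|x w IH] q; first by exists [::].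
have [y <-] := asurj_tlam_onto (sA q) x.
by have [v <-] := IH (tpi y q); exists (y :: v).
Qed.

Lemma foldl_lamw_onto P : (forall q, asurj q) ->
  forall w, exists v, foldl (@lamw n A) v P = w.
Proof.
move=> sA; elim: P => [|q P IH] w; first by exists w.
have [v <-] := IH w; have [u <-] := lamw_onto q sA v.
by exists u.
Qed.

Lemma pact_onto P : (forall q, asurj q) -> forall z, exists y, pact P y = z.
Proof.
move=> sA; elim: P => [|q P IH] z; first by exists z.
have [y <-] := IH z; have [u <-] := sA q y.
by exists u.
Qed.

(** * Synchronization of powers and finiteness of the group *)

Lemma ppiw_sync k m : synchronizing_at A k ->
  exists N, forall w P P', N <= size w -> size P = m -> size P' = m ->
    ppiw w P = ppiw w P'.
Proof.
move=> [s sP]; elim: m => [|m [N IH]].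
  by exists 0 => w P P' _ /size0nil-> /size0nil->.
(* After [k] letters the first factors agree, so from then on they feed the same word, of length at
   least [N], to the remaining factors. *)
exists (k + N) => w [//|q P] [//|q' P'] wN [eP] [eP'].
have kw : size (take k w) == k.
  by rewrite size_takel //; apply: leq_trans wN; apply: leq_addr.
have sE p : piw (take k w) p = s (Tuple kw) by rewrite -(sP (Tuple kw) p).
rewrite -(cat_take_drop k w) !(ppiw_catw, ppiw_cons) !sE; congr (_ :: _).
apply: IH; rewrite ?size_ppiw // size_lamw size_drop.
by rewrite leq_subRL // (leq_trans _ wN) // leq_addr.
Qed.

Lemma pact_loop k v P P' :
  synchronizing_at A k -> v != [::] -> size P = size P' ->
  pact (ppiw v P) = pact P -> pact (ppiw v P') = pact P' -> pact P = pact P'.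
Proof.
move=> sA v0 eP vP vP'.
have [N sN] := ppiw_sync (size P) sA.
(* Repeating [v] preserves both maps and eventually synchronizes the power. *)
pose V m := flatten (nseq m v).
have loop m Q : pact (ppiw v Q) = pact Q -> pact (ppiw (V m) Q) = pact Q.
  move=> vQ; elim: m => //= m IH.
  by rewrite ppiw_catw (pact_ppiw _ vQ).
have VN : N <= size (V N).
  by rewrite size_flatten /shape map_nseq sumn_nseq leq_pmull // lt0n size_eq0.
by rewrite -(loop N P vP) -(loop N P' vP') (sN _ P P').
Qed.

Lemma infinite_of_long_words k : synchronizing_at A k ->
  (forall j, exists w P P', [/\ j <= size w, size P = size P' &
     pact (ppiw w P) <> pact (ppiw w P')]) ->
  infinite_set (automaton_group A).
Proof.
move=> sA long /finite_seqP[s Gs].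
have ins P : pact P \in s.
  by have := automaton_group_pact P; rewrite Gs.
(* The number of pairs of group elements, a bound independent of the number of factors. *)
pose M := #|{: 'I_(size s) * 'I_(size s)}|.
have [w [P [P' [Mw eP neq]]]] := long M.
have idx Q : index (pact Q) s < size s by rewrite index_mem.
pose h (i : 'I_M.+1) :=
  (Ordinal (idx (ppiw (take i w) P)), Ordinal (idx (ppiw (take i w) P'))).
have /injectivePn[i0 [j0 ij0 hij0]] : ~~ injectiveb h.
  by apply/negP => /injectiveP/leq_card; rewrite card_ord ltnn.
wlog lt_ij : i0 j0 ij0 hij0 / i0 < j0.
  move=> W; case: (ltngtP i0 j0) => [|lt_ji|/val_inj e]; first exact: W.
  - by apply: (W j0 i0) => //; rewrite eq_sym.
  - by rewrite e eqxx in ij0.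
have [e e'] : pact (ppiw (take i0 w) P) = pact (ppiw (take j0 w) P) /\
              pact (ppiw (take i0 w) P') = pact (ppiw (take j0 w) P').
  by case: hij0 => /index_inj-> // /index_inj->.
have jw : j0 <= size w by apply: leq_trans Mw; rewrite -ltnS.
pose v := drop i0 (take j0 w).
have ejv : take j0 w = take i0 w ++ v.
  by rewrite -[LHS](cat_take_drop i0) take_takel // ltnW.
have v0 : v != [::].
  by rewrite -size_eq0 size_drop size_takel // subn_eq0 -ltnNge.
have es : size (ppiw (take i0 w) P) = size (ppiw (take i0 w) P').
  by rewrite !size_ppiw.
case: neq; rewrite -(cat_take_drop i0 w) !ppiw_catw; apply: pact_ppiw.
by apply: (pact_loop sA v0 es); rewrite -ppiw_catw -ejv.
Qed.

(** * Bad pairs as words that separate two states *)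

Definition separates w (t1' t2' : state A) S (t1 t2 : state A) :=
  forall U, size U = size S ->
    ppiw w (t1' :: U) = rcons S t1 /\ ppiw w (t2' :: U) = rcons S t2.

(* The second word is pulled back through [S] so that the tail reads [v]. *)
Lemma separates_trans w v a1 a2 b1 b2 c1 c2 S S' : (forall q, asurj q) ->
  separates w a1 a2 S b1 b2 -> separates v b1 b2 S' c1 c2 ->
  exists v' S'', size v' = size v /\ separates (w ++ v') a1 a2 S'' c1 c2.
Proof.
move=> sA sepw sepv; have [v' ev'] := foldl_lamw_onto S sA v.
exists v', (ppiw v' S ++ S'); split.
  rewrite -ev'; elim: (S) (v') => //= q P IH u.
  by rewrite -IH size_lamw.
move=> U; rewrite size_cat size_ppiw => sU.
have eS : size (take (size S) U) = size S by rewrite size_takel // sU leq_addr.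
have [e1 e2] := sepw _ eS.
(* The first [size S] entries of [U] serve as the tail for [w]. The others may evolve differently
   from [a1] and [a2], which is harmless because [sepv] allows any tail. *)
rewrite -(cat_take_drop (size S) U) -!cat_cons !ppiw_catw !(ppiw_cat w).
rewrite e1 e2 !cat_rcons !(ppiw_cat v') ev' !rcons_cat.
by split; congr (_ ++ _); [apply: (sepv _ _).1 | apply: (sepv _ _).2];
  rewrite size_ppiw size_drop sU addKn.
Qed.

Lemma separates_swap w a1 a2 S b1 b2 :
  separates w a1 a2 S b1 b2 -> separates w a2 a1 S b2 b1.
Proof. by move=> sep U /sep[]. Qed.

(** Factor number [i], counted from 0, reads [lam_iter w p i], which forces its next state; the
    extra factor [u] reads the last of these words. *)
Lemma ppiw_forcing w (p s : seq (state A)) (u t : state A) :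
  size s = size p ->
  (forall i, i < size p -> forcing_words (nth u s i) (lam_iter w p i)) ->
  forcing_words t (lam_iter w p (size p)) ->
  ppiw w (rcons p u) = rcons s t.
Proof.
elim: p s w => [|q p IH] [|a s] //= w.
  by move=> _ _ [_ wt]; rewrite ppiw_cons ppiw_nil wt.
move=> [es] ws wt; rewrite ppiw_cons; congr (_ :: _).
  exact: (ws 0 isT).2.
by apply: IH => // i; apply: (ws i.+1).
Qed.

Lemma good_split_separates r (T B : {set state A}) : good_split r T B ->
  exists w a1 a2 S b1 b2, [/\ T = [set a1; a2], B = [set b1; b2], b1 != b2,
    size w = r & separates w a1 a2 S b1 b2].
Proof.
move=> [m [q [p [G [[t1 [t2 [[neq [s [sG w1 w2]]] ->]]] bot ->]]]]].
exists G, (thead p), (thead q), s, t1, t2; split; rewrite ?size_tuple //.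
have force (p' : m.+1.-tuple (state A)) t u :
    (forall i : 'I_m.+1, forcing_words (tnth s i) (lam_iter G p' i)) ->
    forcing_words t (lam_iter G p' m.+1) ->
    ppiw G (rcons p' u) = rcons s t.
  move=> ws wt; apply: ppiw_forcing; rewrite ?size_tuple // => i im.
  by have := ws (Ordinal im); rewrite (tnth_nth u).
move=> U; rewrite size_tuple => sU.
case: (lastP U) sU => // V u; rewrite size_rcons => -[/eqP sV].
(* Dependence on the top alone replaces the tail [U] by the tails of [p] and [q], for which the
   forced states are known. *)
have [_ /(_ u u)[e1 e2]] := bot (Tuple sV) (Tuple sV).
have := congr1 (@seq_of_tpowS _) e1; have := congr1 (@seq_of_tpowS _) e2.
rewrite !(seq_of_tpowS_piw, seq_of_tpowS_state) /= => <- <-.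
by split; apply: force => // i; have [] := sG i.
Qed.

(** Tops and bottoms are unordered pairs, so the roles of the two states may have to be swapped. *)
Lemma good_split_separates_from r (T B : {set state A}) a1 a2 :
  good_split r T B -> T = [set a1; a2] -> a1 != a2 ->
  exists w S b1 b2, [/\ B = [set b1; b2], b1 != b2, size w = r &
    separates w a1 a2 S b1 b2].
Proof.
move=> /good_split_separates[w [c1 [c2 [S [b1 [b2 [-> eB nb sw sep]]]]]]] eT na.
have : a1 \in [set c1; c2] by rewrite eT set21.
have : a2 \in [set c1; c2] by rewrite eT set22.
rewrite !inE => /orP[]/eqP e2 /orP[]/eqP e1.
- by rewrite e1 e2 eqxx in na.
- exists w, S, b2, b1; split; rewrite // 1?eq_sym //.
    by rewrite eB finset.setUC.
  by rewrite e1 e2; apply: separates_swap.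
- by exists w, S, b1, b2; rewrite e1 e2.
- by rewrite e1 e2 eqxx in na.
Qed.

Lemma circuit_separates r :
  (forall q, asurj q) -> has_circuit (@bad_edge n A r) ->
  forall j, exists w a1 a2 S b1 b2, [/\ b1 != b2, size w = j * r &
    separates w a1 a2 S b1 b2].
Proof.
move=> sA [c c0 cyc] j.
(* The induction appends one edge at the end of the path, so the circuit is followed backwards from
   its final vertex. *)
have pred T : T \in c -> exists2 T', T' \in c & good_split r T' T.
  move=> Tc; exists (prev c T); first by rewrite mem_prev.
  by have /asboolP[] := prev_cycle cyc Tc.
suff all T : T \in c -> exists w a1 a2 S b1 b2, [/\ T = [set b1; b2], b1 != b2,
    size w = j * r & separates w a1 a2 S b1 b2].
  case: c c0 {cyc pred} all => // T c _ /(_ T (mem_head _ _)).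
  by move=> [w [a1 [a2 [S [b1 [b2 [? ? ? ?]]]]]]]; exists w, a1, a2, S, b1, b2.
elim: j T => [|j IH] T /pred[T' T'c gs].
  (* The incoming edge serves only to present [T] as a pair of distinct states; the word is
     empty. *)
  have [_ [_ [_ [_ [b1 [b2 [_ eT nb _ _]]]]]]] := good_split_separates gs.
  by exists [::], b1, b2, [::], b1, b2; split=> // U /size0nil->.
have [w [a1 [a2 [S [b1 [b2 [eT' nb sw sep]]]]]]] := IH _ T'c.
have [v [S' [c1 [c2 [eT nc sv sep']]]]] := good_split_separates_from gs eT' nb.
have [v' [S'' [sv' sep'']]] := separates_trans sA sep sep'.
by exists (w ++ v'), a1, a2, S'', c1, c2; rewrite size_cat sw sv' sv addnC.
Qed.

End Powers.

Theorem corollary1p2 (n : nat) (A : transducer n) (k r : nat)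
    (hn : 2 <= n)
    (hA : in_Hn A)
    (hk : synchronizing_at A k)
    (hr : k <= r)
    (hcirc : has_circuit (@bad_edge n A r)) :
  infinite_set (automaton_group A).
Proof.
have sA := in_Hn_asurj hA; have [[_ _ minA] _] := hA.
have sep := circuit_separates sA hcirc.
(* This makes the words of length [j * r] arbitrarily long. Level 0 would leave a single state. *)
have r0 : 0 < r.
  have [_ [_ [_ [_ [b1 [b2 [nb _ _]]]]]]] := sep 0.
  case: k hk hr => [[s sP] _|k _]; last exact: leq_trans.
  by move: nb; rewrite [b1](sP [tuple]) [b2](sP [tuple]) eqxx.
apply: (infinite_of_long_words hk) => j.
have [w [a1 [a2 [S [b1 [b2 [nb sw sepw]]]]]]] := sep j.
have [e1 e2] := sepw S erefl.
(* Any tail of the right size would do; [S] is one. *)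
exists w, (a1 :: S), (a2 :: S); split=> //; first by rewrite sw leq_pmulr.
rewrite e1 e2 => e; case/eqP: nb; apply: minA => z.
have [y <-] := pact_onto S sA z.
by have := congr1 (fun f => f y) e; rewrite /pact !foldl_rcons.
Qed.
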